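(* Let $B\subseteq A$ be a (unital) inclusion of multimatrix algebras over $\mathbb{C}$ and let $m\geq 2$. The inclusion matrix of $B \subseteq A$ satisfies a depth $2m$ inequality if and only if $m(V_u)\leq m-1$ for every simple $A$-module $V_u$.
   Context: A multimatrix algebra is a finite direct product of full matrix algebras over $\mathbb{C}$. Let $V_1,\dots,V_s$ be the simple $A$-modules and $W_1,\dots,W_r$ the simple $B$-modules up to isomorphism; the inclusion matrix is the $r\times s$ matrix $M=(m_{ij})$, where $m_{ij}$ is the multiplicity of $W_i$ in the restriction $V_j\!\downarrow_B$. Powers of $M$ are understood as $M^1=M$, $M^2=MM^t$, $M^3=MM^tM$, etc.; inequalities are entrywise. $M$ satisfies a depth $n$ inequality ($n\ge 2$) if $M^{n+1}\le qM^{n-1}$ for some positive integer $q$. Write $W_i\sim W_j$ if there is a simple $A$-module $V$ such that $W_i$ and $W_j$ are both constituents of $V\!\downarrow_B$, and let $\approx$ be the transitive closure of $\sim$. The distance $d(W_i,W_j)$ is defined as follows: $d(W_i,W_i)=0$; if $i\ne j$ and $W_i\approx W_j$, it is the smallest $k\geq 1$ such that there is a chain $W_i=W_{i_0}\sim W_{i_1}\sim\cdots\sim W_{i_k}=W_j$ of simple $B$-modules; and $d(W_i,W_j)=-\infty$ if $W_i\not\approx W_j$. For a simple $A$-module $V_u$ let $\mathcal{V}_u$ be the set of irreducible constituents of $V_u\!\downarrow_B$ (all lying in one $\approx$-class), put $d(W_i,\mathcal{V}_u)=\min_{W_j\in\mathcal{V}_u}d(W_i,W_j)$, and let $m(V_u)=\max_{1\le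 i\le r}d(W_i,\mathcal{V}_u)$. *)

(* Defs.v *)
From HB Require Import structures.
From Stdlib Require Import Relation_Operators.
From mathcomp Require Import all_boot all_order all_algebra.
From mathcomp Require Import boolp reals constructive_ereal complex.
Set Implicit Arguments. Unset Strict Implicit. Unset Printing Implicit Defensive.
Import Order.TTheory GRing.Theory Num.Theory.
Local Open Scope ring_scope.

(* The maps p l exhibit A as a direct product of the matrix algebras
   'M[C]_((n l).+1).  (An algType is nonzero, so k > 0.) *)
Definition multimatrix (C : fieldType) (A : algType C) : Prop :=
  exists (k : nat) (n : 'I_k -> nat)
         (p : forall l, {lrmorphism A -> 'M[C]_((n l).+1)}),
    forall X : (forall l, 'M[C]_((n l).+1)), exists! a : A, forall l, p l a = X l.

Definition module_iso (A : pzRingType) (U V : lmodType A) : Prop :=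
  exists g : {linear U -> V}, bijective g.

Definition simple_module (A : pzRingType) (V : lmodType A) : Prop :=
  (exists v : V, v != 0) /\
  forall S : {pred V}, submod_closed S ->
    (forall v, v \in S -> v = 0) \/ (forall v, v \in S).

(* V 0, ..., V (s - 1) represent each isomorphism class of simple A-modules
   exactly once. *)
Definition simple_modules (A : pzRingType) (s : nat) (V : 'I_s -> lmodType A)
    : Prop :=
  [/\ forall j, simple_module (V j),
      forall j j', module_iso (V j) (V j') -> j = j'
    & forall U : lmodType A, simple_module U -> exists j, module_iso U (V j)].

Definition restrict_module (B A : pzRingType) (f : {rmorphism B -> A})
  (V : lmodType A) : Type := V.

Section Restrict.
Variables (B A : pzRingType) (f : {rmorphism B -> A}) (V : lmodType A).

HB.instance Definition _ := GRing.Zmodule.copy (restrict_module f V) V.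

Definition restrict_scale (b : B) (v : restrict_module f V) :
    restrict_module f V :=
  f b *: (v : V).

Fact restrict_scaleA a b v :
  restrict_scale a (restrict_scale b v) = restrict_scale (a * b) v.
Proof. by rewrite /restrict_scale scalerA rmorphM. Qed.

Fact restrict_scale1 : left_id 1 restrict_scale.
Proof. by move=> v; rewrite /restrict_scale rmorph1 scale1r. Qed.

Fact restrict_scaleDr : right_distributive restrict_scale +%R.
Proof. by move=> b u v; rewrite /restrict_scale scalerDr. Qed.

Fact restrict_scaleDl v : {morph restrict_scale^~ v : a b / a + b}.
Proof. by move=> a b; rewrite /restrict_scale rmorphD scalerDl. Qed.

HB.instance Definition _ := GRing.Zmodule_isLmodule.Build B (restrict_module f V)
  restrict_scaleA restrict_scale1 restrict_scaleDr restrict_scaleDl.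
End Restrict.

(* Intended for W simple and X semisimple, where every composition factor of X
   embeds in X. *)
Definition constituent (B : pzRingType) (W X : lmodType B) : Prop :=
  exists g : {linear W -> X}, injective g.

(* X is the direct sum of the images of the maps g i k, that is, of mu i copies
   of W i for each i; so mu i is the multiplicity of W i in X. *)
Definition multiplicities (B : pzRingType) (r : nat) (W : 'I_r -> lmodType B)
    (X : lmodType B) (mu : 'I_r -> nat) : Prop :=
  exists g : (forall i, 'I_(mu i) -> {linear W i -> X}),
    forall x : X, exists! w : (forall i, 'I_(mu i) -> W i),
      x = \sum_i \sum_k g i k (w i k).

Definition inclusion_matrix (B A : pzRingType) (f : {rmorphism B -> A})
    (r s : nat) (W : 'I_r -> lmodType B) (V : 'I_s -> lmodType A)
    (M : 'M[nat]_(r, s)) : Prop :=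
  forall j, multiplicities W (restrict_module f (V j) : lmodType B) (M^~ j).

(* altpow M b k is the power of M of exponent k.*2 + b, for the alternating
   products M, M M^t, M M^t M, ... *)
Definition altpow (r s : nat) (M : 'M[nat]_(r, s)) (b : bool) (k : nat) :
    'M[nat]_(r, if b then s else r) :=
  if b return 'M[nat]_(r, if b then s else r)
  then ((M *m M^T) ^+ k : 'M[nat]_r) *m M else ((M *m M^T) ^+ k : 'M[nat]_r).

(* For n > 0, n.+1 and n.-1 both have the parity of n.+1. *)
Definition depth_inequality (r s : nat) (M : 'M[nat]_(r, s)) (n : nat) : Prop :=
  exists2 q : nat, (0 < q)%N &
    forall i j, (altpow M (odd n.+1) n.+1./2 i j
                 <= q * altpow M (odd n.+1) n.-1./2 i j)%N.

Section Distance.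
Variables (T : finType) (e : rel T).

Definition chain (x y : T) (k : nat) : bool :=
  (0 < k)%N && [exists p : k.-tuple T, path e x p && (last x p == y)].

Fact clos_trans_chain x y : clos_trans T e x y -> exists k, chain x y k.
Proof.
suff H : clos_trans T e x y ->
    exists2 p, p != [::] & path e x p && (last x p == y).
  move=> /H[p p0 pxy]; exists (size p); rewrite /chain lt0n size_eq0 p0 /=.
  by apply/existsP; exists (in_tuple p).
elim=> {x y} [x y exy|x y z _ [p p0 /andP[xp /eqP py]] _ [q q0 /andP[yq qz]]].
  by exists [:: y] => //=; rewrite exy eqxx.
exists (p ++ q); first by case: p p0 {xp py}.
by rewrite cat_path last_cat py xp yq qz.
Qed.

Definition distance (x y : T) : \bar int :=
  if x == y then 0%E
  else match pselect (clos_trans T e x y) with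
       | left xy => ((ex_minn (clos_trans_chain xy))%:Z)%:E
       | right _ => -oo%E
       end.
End Distance.

Section Modules.
Variables (B A : pzRingType) (f : {rmorphism B -> A}).
Variables (r : nat) (W : 'I_r -> lmodType B).

Definition linked (i j : 'I_r) : Prop :=
  exists V : lmodType A, [/\ simple_module V,
    constituent (W i) (restrict_module f V : lmodType B)
  & constituent (W j) (restrict_module f V : lmodType B)].

Definition simple_distance (i j : 'I_r) : \bar int :=
  distance (fun i' j' => `[< linked i' j' >]) i j.

Definition constituents (V : lmodType A) : {set 'I_r} :=
  [set i | `[< constituent (W i) (restrict_module f V : lmodType B) >]].

(* The minimum of a nonempty set when S is nonempty; +oo is neutral for it. *)
Definition distance_to (i : 'I_r) (S : {set 'I_r}) : \bar int :=
  \big[Order.min/+oo%E]_(j in S) simple_distance i j.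

Definition max_distance (V : lmodType A) : \bar int :=
  \big[Order.max/-oo%E]_(i < r) distance_to i (constituents V).
End Modules.

(* Main.v *)
Require Import Defs.
From HB Require Import structures.
From Stdlib Require Import Relation_Operators.
From mathcomp Require Import all_boot all_order all_algebra.
From mathcomp Require Import boolp reals constructive_ereal complex.
Set Implicit Arguments. Unset Strict Implicit. Unset Printing Implicit Defensive.
Import Order.TTheory GRing.Theory Num.Theory.
Local Open Scope ring_scope.

(* Entrywise domination up to a factor q only compares supports, so the depth
   2m inequality says supp (N^m M) is contained in supp (N^(m-1) M) for
   N = M M^t.  By Schur's lemma M i u > 0 iff W_i is a constituent of V_u, hence
   N i j > 0 iff W_i ~ W_j, and N^k M i u > 0 iff a chain of k links leads from
   W_i to some constituent of V_u.  Such a chain can be prolonged by loops at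
   W_i, so "k links" may be read "at most k links", that is, distance at most k;
   and once the supports of N^k M stop growing they are stationary. *)

Lemma schur (B : pzRingType) (U V : lmodType B) (g : {linear U -> V}) :
  simple_module U -> simple_module V -> (exists u, g u != 0) -> bijective g.
Proof.
move=> [_ simU] [_ simV] [u0 gu0].
have kerg : forall u, g u = 0 -> u = 0.
  have [|kerg u gu|kerg] := simU [pred u | g u == 0].
  - split=> [|a u v]; rewrite !inE ?linear0 //.
    by rewrite linearP => /eqP-> /eqP->; rewrite scaler0 addr0.
  - by apply: kerg; rewrite inE gu.
  - by have := kerg u0; rewrite inE (negPf gu0).
have [|img0|img] := simV [pred v | `[< exists u, g u = v >]].
- split=> [|a x y]; rewrite !inE; first by apply/asboolP; exists 0; rewrite linear0.
  move=> /asboolP[u <-] /asboolP[v <-]; apply/asboolP.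
  by exists (a *: u + v); rewrite linearP.
- by move: gu0; rewrite (img0 (g u0)) ?eqxx // inE; apply/asboolP; exists u0.
- have /choice[h hK] : forall v, exists u, g u = v.
    by move=> v; apply/asboolP; have := img v; rewrite inE.
  exists h => // u; apply/eqP; rewrite -subr_eq0; apply/eqP/kerg.
  by rewrite linearB hK subrr.
Qed.

(** Following an embedding of [W i] by the coordinates of the direct sum gives linear maps
    [W i -> W i']. By Schur these vanish for [i' != i], and for [i' = i] there is no coordinate if
    [mu i = 0], so the embedding would be zero. Conversely, a summand embeds because decompositions
    are unique. *)
Lemma constituent_multiplicity (B : pzRingType) (r : nat) (W : 'I_r -> lmodType B)
    (X : lmodType B) (mu : 'I_r -> nat) (i : 'I_r) :
    (forall i, simple_module (W i)) ->
    (forall i i', module_iso (W i) (W i') -> i = i') ->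
  multiplicities W X mu -> constituent (W i) X <-> (0 < mu i)%N.
Proof.
move=> simW isoW [g /choice[c hc]]; split=> [[h injh]|mu_gt0].
  rewrite lt0n; apply/eqP => mu0.
  have c_linear i' k : linear (fun v => c (h v) i' k).
    (* Coordinates are linear by uniqueness: the combined coordinates also decompose the combined
       vector. *)
    move=> a u v; suff -> : c (h (a *: u + v)) =
        (fun i' k => a *: c (h u) i' k + c (h v) i' k) by [].
    apply: (hc _).2; rewrite linearP {1}(hc (h u)).1 {1}(hc (h v)).1.
    rewrite scaler_sumr -big_split; apply: eq_bigr => i1 _ /=.
    rewrite scaler_sumr -big_split; apply: eq_bigr => k1 _ /=.
    by rewrite linearP.
  have c0 i' k v : c (h v) i' k = 0.
    apply/eqP/negP => /negP cv.
    pose lc := GRing.isLinear.Build _ _ _ _ _ (c_linear i' k).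
    pose l : {linear W i -> W i'} := HB.pack (fun v => c (h v) i' k) lc.
    have l_bij : bijective l by apply: schur => //; exists v.
    have ii' : i = i' by apply: isoW; exists l.
    by move: k {l_bij l lc cv}; rewrite -ii' mu0 => -[].
  have [[v /eqP v0] _] := simW i; apply/v0/injh.
  rewrite (hc (h v)).1 linear0 big1 // => i' _; rewrite big1 // => k _.
  by rewrite c0 linear0.
pose k0 := Ordinal mu_gt0; exists (g i k0) => u v guv.
pose z i' (k : 'I_(mu i')) : W i' := 0.
(* The family with [x] in slot [(i, k0)] and zero in all other slots. *)
pose w (x : W i) := dfwith z (dfwith (z i) (i := k0) x).
have sum_w x : g i k0 x = \sum_i' \sum_k g i' k (w x i' k).
  rewrite (bigD1 i) //= (bigD1 k0) //= /w !dfwith_in !big1 ?addr0 // => [i' ii'|k kk0].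
    by rewrite dfwith_out 1?eq_sym // big1 // => k _; rewrite /z linear0.
  by rewrite dfwith_out 1?eq_sym // /z linear0.
have wuv : w u = w v.
  have [_ uniq_c] := hc (g i k0 u).
  by rewrite -(uniq_c _ (sum_w u)); apply: uniq_c; rewrite guv sum_w.
by have := congr1 (fun w => w i k0) wuv; rewrite /w !dfwith_in.
Qed.

Lemma multiplicity_neq0 (B : pzRingType) (r : nat) (W : 'I_r -> lmodType B)
    (X : lmodType B) (mu : 'I_r -> nat) (x : X) :
  multiplicities W X mu -> x != 0 -> exists i, (0 < mu i)%N.
Proof.
move=> [g /(_ x)[w [-> _]]] sum_neq0.
apply/existsP; apply: contraT; rewrite negb_exists => /forallP mu0.
case/eqP: sum_neq0; rewrite big1 // => i _; rewrite big1 // => k.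
by have := mu0 i; rewrite (leq_ltn_trans _ (ltn_ord k)).
Qed.

(** [linked] ranges over all simple A-modules, while [M] only knows the representatives [V u]; this
    passes from the former to the latter. *)
Lemma constituent_restrict_iso (B A : pzRingType) (f : {rmorphism B -> A})
    (W : lmodType B) (V V' : lmodType A) :
  module_iso V V' ->
  constituent W (restrict_module f V : lmodType B) ->
  constituent W (restrict_module f V' : lmodType B).
Proof.
move=> [g /bij_inj injg] [h injh].
have gh_linear : linear (fun w => g (h w) : restrict_module f V').
  by move=> b u v; rewrite linearP; exact: (linearP g).
pose lc := GRing.isLinear.Build _ _ _ _ _ gh_linear.
pose l : {linear W -> restrict_module f V'} :=
  HB.pack (fun w => g (h w) : restrict_module f V') lc.
by exists l => u v /injg/injh.
Qed.

Section InclusionMatrix.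
Variables (B A : pzRingType) (f : {rmorphism B -> A}) (r s : nat).
Variables (W : 'I_r -> lmodType B) (V : 'I_s -> lmodType A) (M : 'M[nat]_(r, s)).
Hypotheses (hW : simple_modules W) (hV : simple_modules V).
Hypothesis hM : inclusion_matrix f W V M.

Lemma mem_constituents i u : (i \in constituents f W (V u)) = (0 < M i u)%N.
Proof.
have [simW isoW _] := hW.
rewrite inE; apply/asboolP/idP => [/(constituent_multiplicity i simW isoW (hM u)).1|] //.
exact: (constituent_multiplicity i simW isoW (hM u)).2.
Qed.

(** Ensures that the minimum in [distance_to] is not its default value [+oo]. *)
Lemma constituents_neq0 u : exists i, i \in constituents f W (V u).
Proof.
have [/(_ u)[[v v0] _] _ _] := hV.
have [i Miu] := multiplicity_neq0 (hM u) v0.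
by exists i; rewrite mem_constituents.
Qed.

Lemma linked_inclusion_matrix i j :
  linked f W i j <-> exists2 u, (0 < M i u)%N & (0 < M j u)%N.
Proof.
have [simV _ allV] := hV.
split=> [[X [simX iX jX]]|[u]].
  have [u Xu] := allV _ simX; exists u; rewrite -mem_constituents inE.
    by apply/asboolP; apply: constituent_restrict_iso iX.
  by apply/asboolP; apply: constituent_restrict_iso jX.
rewrite -!mem_constituents !inE => /asboolP iu /asboolP ju.
by exists (V u).
Qed.

End InclusionMatrix.

Lemma bounded_multiple_support (r s : nat) (P Q : 'M[nat]_(r, s)) :
  (exists2 q : nat, (0 < q)%N & forall i j, (P i j <= q * Q i j)%N) <->
  (forall i j, (0 < P i j)%N -> (0 < Q i j)%N).
Proof.
split=> [[q _ PQ] i j Pij|suppPQ].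
  by have := leq_trans Pij (PQ i j); rewrite muln_gt0 => /andP[].
(* The sum of all entries bounds each entry of [P]; the successor makes it positive. *)
exists (\sum_i \sum_j P i j).+1 => // i j.
have [->|/suppPQ Qij] := posnP (P i j); first by [].
rewrite (leq_trans _ (leq_pmulr _ Qij)) // (bigD1 i) // (bigD1 j) //=.
by rewrite -addnA ltnW // ltnS leq_addr.
Qed.

Lemma mulmx_nat_gt0 (r s t : nat) (P : 'M[nat]_(r, s)) (Q : 'M[nat]_(s, t)) i j :
  (0 < (P *m Q) i j)%N <-> exists2 l, (0 < P i l)%N & (0 < Q l j)%N.
Proof.
rewrite mxE lt0n sum_nat_eq0 negb_forall; split=> [/existsP[l]|[l Pil Qlj]].
  by rewrite /= -lt0n muln_gt0 => /andP[]; exists l.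
by apply/existsP; exists l; rewrite /= -lt0n muln_gt0 Pil.
Qed.

Section Walks.
Variables (r : nat) (N : 'M[nat]_r) (e : rel 'I_r).
Hypothesis eN : forall i j, e i j = (0 < N i j)%N.

Lemma expmx_nat_gt0 k i j :
  (0 < (N ^+ k) i j)%N <-> exists p, [/\ size p = k, path e i p & last i p = j].
Proof.
elim: k i => [|k IHk] i.
  rewrite expr0 mxE; split=> [|[p [/size0nil-> _ /= ->]]]; last by rewrite eqxx.
  by case: eqP => // -> _; exists [::].
rewrite exprS; split=> [/mulmx_nat_gt0[l]|[[|l p] [//= [pk] /andP[il lp] pj]]].
  rewrite -eN => il /IHk[p [pk lp pj]].
  by exists (l :: p); split=> //=; rewrite ?pk ?il.
by apply/mulmx_nat_gt0; exists l; [rewrite -eN|apply/IHk; exists p].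
Qed.

(** The loop is put in front of the walk, so only its starting point has to carry one. *)
Lemma expmx_nat_gt0_leq k n i j :
  e i i -> (k <= n)%N -> (0 < (N ^+ k) i j)%N -> (0 < (N ^+ n) i j)%N.
Proof.
move=> eii /subnK<- Nij; elim: (n - k)%N => // d IHd.
by rewrite addSn exprS; apply/mulmx_nat_gt0; exists i; rewrite -?eN.
Qed.

Lemma clos_trans_expmx i j : clos_trans _ e i j -> exists k, (0 < (N ^+ k) i j)%N.
Proof.
move=> /clos_trans_chain[k /andP[_ /existsP[p /andP[ip /eqP pj]]]].
by exists k; apply/expmx_nat_gt0; exists p; rewrite size_tuple.
Qed.

Lemma expmx_chain k i j : chain e i j k <-> (0 < k)%N /\ (0 < (N ^+ k) i j)%N.
Proof.
rewrite /chain; split=> [/andP[-> /existsP[p /andP[ip /eqP pj]]]|[-> ]].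
  by split=> //; apply/expmx_nat_gt0; exists p; rewrite size_tuple.
move=> /expmx_nat_gt0[p [/eqP pk ip pj]]; apply/existsP.
by exists (Tuple pk); rewrite /= ip pj eqxx.
Qed.

Lemma expmx_clos_trans k i j : (0 < (N ^+ k) i j)%N -> i = j \/ clos_trans _ e i j.
Proof.
elim: k i => [|k IHk] i; first by rewrite expr0 mxE; case: eqP; [left|].
rewrite exprS => /mulmx_nat_gt0[l]; rewrite -eN => il /IHk[<-|lj]; right.
  exact: t_step.
exact: t_trans (t_step _ _ _ _ il) lj.
Qed.

Lemma distance_expmx_le k i j : (0 < (N ^+ k) i j)%N -> (distance e i j <= k%:Z%:E)%E.
Proof.
move=> Nij; rewrite /distance; case: eqP => [_|ij]; first by rewrite lee_fin.
case: pselect => [eij|_]; last exact: leNye.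
rewrite lee_fin lez_nat; case: ex_minnP => n _; apply; apply/expmx_chain.
(* A chain has positive length; [k = 0] would force [i = j]. *)
by split=> //; case: k Nij => //; rewrite expr0 mxE; case: eqP.
Qed.

(* The hypothesis clos_trans excludes the distance -oo. *)
Lemma distance_le_expmx k i j :
    clos_trans _ e i j -> (distance e i j <= k%:Z%:E)%E ->
  exists2 n, (n <= k)%N & (0 < (N ^+ n) i j)%N.
Proof.
move=> eij; rewrite /distance; case: eqP => [<- _|_].
  by exists 0; rewrite ?expr0 ?mxE ?eqxx.
case: pselect => // eij'; rewrite lee_fin lez_nat.
by case: ex_minnP => n /expmx_chain[_ Nij] _ nk; exists n.
Qed.

End Walks.

(** Split off the first step of the walk, shorten the rest by induction to [k] steps, and apply
    stability to the resulting [k.+1] steps. *)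
Lemma mulmx_expmx_gt0 (r s : nat) (N : 'M[nat]_r) (M : 'M[nat]_(r, s)) k d :
    (forall i u, (0 < (N ^+ k.+1 *m M) i u)%N -> (0 < (N ^+ k *m M) i u)%N) ->
  forall i u, (0 < (N ^+ (d + k) *m M) i u)%N -> (0 < (N ^+ k *m M) i u)%N.
Proof.
move=> stable; elim: d => [|d IHd] i u //.
rewrite addSn exprS -mulmxA => /mulmx_nat_gt0[l Nil /IHd Nlu].
by apply: stable; rewrite exprS -mulmxA; apply/mulmx_nat_gt0; exists l.
Qed.

Theorem theorem3p13 (R : realType) (A B : algType R[i])
    (hA : multimatrix A) (hB : multimatrix B)
    (f : {lrmorphism B -> A}) (hf : injective f)
    (r s : nat) (W : 'I_r -> lmodType B) (V : 'I_s -> lmodType A)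
    (hW : simple_modules W) (hV : simple_modules V)
    (M : 'M[nat]_(r, s)) (hM : inclusion_matrix f W V M)
    (m : nat) (hm : (2 <= m)%N) :
  depth_inequality M (2 * m) <->
  forall u : 'I_s, (max_distance f W (V u) <= (m%:Z - 1)%:E)%E.
Proof.
(* From here on [m] is one less than in the statement, so the bound on the distances is [m]
   itself. *)
case: m hm => // m _; pose N := M *m M^T.
pose e i j := `[< linked f W i j >].
have linkP := linked_inclusion_matrix hW hV hM.
have eN i j : e i j = (0 < N i j)%N.
  apply/asboolP/idP => [/linkP[u iu ju]|/mulmx_nat_gt0[u iu]].
    by apply/mulmx_nat_gt0; exists u; rewrite ?mxE.
  by rewrite mxE => ju; apply/linkP; exists u.
have e_col i j u : (0 < M i u)%N -> (0 < M j u)%N -> e i j.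
  by move=> iu ju; apply/asboolP/linkP; exists u.
(* A nonzero row [i] of [N ^+ k *m M] needs a nonzero entry in row [i] of [M], whence a loop at
   [i]. *)
have e_refl k i u : (0 < (N ^+ k *m M) i u)%N -> e i i.
  case: k => [|k]; first by rewrite expr0 mul1mx => iu; exact: (e_col _ _ _ iu iu).
  rewrite exprS -!mulmxA => /mulmx_nat_gt0[l iu _]; exact: (e_col _ _ _ iu iu).
have -> : m.+1%:Z - 1 = m%:Z by rewrite -addn1 PoszD addrK.
have depthE : depth_inequality M (2 * m.+1) <-> forall i u,
    (0 < (N ^+ m.+1 *m M) i u)%N -> (0 < (N ^+ m *m M) i u)%N.
  (* The exponents [2m+3] and [2m+1] are odd, so both alternating products end in [M]. *)
  rewrite /depth_inequality mul2n oddS odd_double.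
  have -> : m.+1.*2.+1./2 = m.+1 by rewrite -[_./2]/(uphalf m.+1.*2) uphalf_double.
  have -> : m.+1.*2.-1./2 = m by rewrite doubleS -[_./2]/(uphalf m.*2) uphalf_double.
  exact: (bounded_multiple_support (N ^+ m.+1 *m M) (N ^+ m *m M)).
rewrite depthE; split=> [supp u|dist_le i u].
  apply/bigmax_leP; split=> [|i _]; first exact: leNye.
  have [[k Niu]|disc] := pselect (exists k, (0 < (N ^+ k *m M) i u)%N).
    have /mulmx_nat_gt0[j Nij ju] : (0 < (N ^+ m *m M) i u)%N.
      (* Walks longer than [m] are shortened by stationarity, the others prolonged by loops at
         [i]. *)
      have [km|/ltnW/subnK mk] := leqP k m; last first.
        by rewrite -mk in Niu; exact: mulmx_expmx_gt0 supp _ _ Niu.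
      have /mulmx_nat_gt0[j Nij ju] := Niu.
      apply/mulmx_nat_gt0; exists j => //.
      exact: (expmx_nat_gt0_leq eN) (e_refl _ _ _ Niu) km Nij.
    apply/bigmin_leP; right; exists j; first by rewrite (mem_constituents hW hM).
    exact: (distance_expmx_le eN Nij).
  (* No walk leads from [i] to [V u], so a single constituent [j] suffices: a class different from
     that of [i] gives distance [-oo]. *)
  have [j] := constituents_neq0 hW hV hM u; rewrite (mem_constituents hW hM) => ju.
  apply/bigmin_leP; right; exists j; first by rewrite (mem_constituents hW hM).
  rewrite /simple_distance /distance; case: eqP => [_|_]; first by rewrite lee_fin.
  case: pselect => [eij|_]; last exact: leNye.
  have [k Nij] := clos_trans_expmx eN eij; case: disc; exists k.
  by apply/mulmx_nat_gt0; exists j.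
move=> Niu; have /mulmx_nat_gt0[j Nij ju] := Niu.
have /bigmax_leP[_ /(_ i isT) dist_iu] := dist_le u.
case: (bigmin_leP _ _ _ _ dist_iu) => [//|[j']]; rewrite (mem_constituents hW hM) => j'u.
(* The constituent [j'] within distance [m] need not be the end [j] of the given walk. Both lie in
   [V u], so [i] is connected to [j'] and the distance is not [-oo]. *)
have jj' : clos_trans _ e j j' by apply: t_step; exact: e_col ju j'u.
have eij' : clos_trans _ e i j'.
  have [->|eij] := expmx_clos_trans eN Nij; first exact: jj'.
  exact: (t_trans _ _ _ _ _ eij jj').
move=> /(distance_le_expmx eN eij')[n nm Nij'].
apply/mulmx_nat_gt0; exists j' => //.
exact: (expmx_nat_gt0_leq eN) (e_refl _ _ _ Niu) nm Nij'.
Qed.
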